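(* $K_4^{(3)-}\in\mathbf{FACTOR}_3^{\mathrm{cherry},1}$.
   Context: $K_4^{(3)-}$ is the $3$-graph on $4$ vertices with exactly $3$ edges. A $3$-graph $H$ has edge set $E(H)\subseteq\binom{V(H)}{3}$; $\delta_1(H)$ is the minimum number of edges containing a vertex. An $F$-factor is a set of vertex-disjoint copies of $F$ covering all vertices. An $(n,p,\mu,\mathrm{cherry})$ $k$-graph is a $k$-graph $H$ on a vertex set $V$ with $|V|=n$ such that for all $P,Q\subseteq V^{k-1}$, writing $\mathcal{K}(P,Q)=\{(x_1,\dots,x_k)\in V^k:(x_1,\dots,x_{k-1})\in P,\ (x_2,\dots,x_k)\in Q\}$ and $e(P,Q)=|\{(x_1,\dots,x_k)\in\mathcal{K}(P,Q):\{x_1,\dots,x_k\}\in E(H)\}|$, we have $e(P,Q)\ge p|\mathcal{K}(P,Q)|-\mu n^k$. $\mathbf{FACTOR}_3^{\mathrm{cherry},1}$ is the class of $3$-graphs $F$ such that for all $0<p,\alpha<1$ there exist $n_0$ and $\mu>0$ such that every $(n,p,\mu,\mathrm{cherry})$ $3$-graph $H$ with $\delta_1(H)\ge\alpha n^{2}$, $n\ge n_0$ and $v(F)\mid n$ has an $F$-factor. *)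

(* Defs.v *)
From HB Require Import structures.
From mathcomp Require Import all_boot all_order all_algebra.
From mathcomp Require Import reals.
Set Implicit Arguments. Unset Strict Implicit. Unset Printing Implicit Defensive.
Import Order.TTheory GRing.Theory Num.Theory.
Local Open Scope ring_scope.

Definition is_3graph (V : finType) (E : {set {set V}}) : Prop :=
  forall e, e \in E -> #|e| = 3%N.

Definition deg (V : finType) (E : {set {set V}}) (v : V) : nat :=
  #|[set e in E | v \in e]|.

Definition Kcherry (V : finType) (P Q : {set V * V}) : {set V * V * V} :=
  [set x : V * V * V | ((x.1.1, x.1.2) \in P) && ((x.1.2, x.2) \in Q)].

Definition Echerry (V : finType) (E : {set {set V}}) (P Q : {set V * V})
  : {set V * V * V} :=
  [set x in Kcherry P Q | [set x.1.1; x.1.2; x.2] \in E].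

Definition cherry_dense (R : realType) (n : nat) (p mu : R)
  (E : {set {set 'I_n}}) : Prop :=
  forall P Q : {set 'I_n * 'I_n},
    p * (#|Kcherry P Q|)%:R - mu * (n%:R ^+ 3) <= (#|Echerry E P Q|)%:R.

Definition is_copy (k : nat) (F : {set {set 'I_k}}) (V : finType)
  (E : {set {set V}}) (f : 'I_k -> V) : Prop :=
  injective f /\ forall e, e \in F -> f @: e \in E.

Definition has_factor (k : nat) (F : {set {set 'I_k}}) (V : finType)
  (E : {set {set V}}) : Prop :=
  exists Pt : {set {set V}}, partition Pt [set: V] /\
    forall S, S \in Pt -> exists f : 'I_k -> V, is_copy F E f /\ S = f @: [set: 'I_k].

(* K_4^{(3)-}: the 3-graph on 4 vertices with exactly 3 edges
   (the three triples containing vertex 0). *)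
Definition K4minus : {set {set 'I_4}} :=
  [set e : {set 'I_4} | (#|e| == 3%N) && (ord0 \in e)].

(* Main.v *)
(* Cherry-density says that for almost every vertex [a] the link graph of [a] is
   dense between any two sets of vertices. Hence three applications of it find a
   copy of K_4^{(3)-} in any four linear-sized sets, and a greedy tiling leaves
   only few vertices uncovered.
   For the absorption, a vertex [q] has a link of quadratic size, so again by
   cherry-density linearly many vertices [w] (its partners) share quadratically
   many link edges with [q]; then there are cubically many triples [S] such that
   both [q, S] and [w, S] are copies. Given four vertices [q_i], take a copy
   formed by partners [w_i] and such triples [S_i]: the 16 vertices are tiled by
   the [w_i, S_i], and together with the [q_i] by the [q_i, S_i] and the copy
   [w_1 w_2 w_3 w_4]. A positive proportion of the 16-tuples absorbs any given
   four vertices, so a linear-sized disjoint family absorbs all small leftovers. *)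
Require Import Defs.
From HB Require Import structures.
From mathcomp Require Import all_boot all_order all_algebra.
From mathcomp Require Import reals.
From mathcomp Require Import ring lra zify.
Set Implicit Arguments. Unset Strict Implicit. Unset Printing Implicit Defensive.
Import Order.TTheory GRing.Theory Num.Theory.
Local Open Scope ring_scope.

(** * Tilings of multisets by copies, greedy removal, absorbers *)

Section Tilings.
Variables (V : finType) (E : {set {set V}}).
Hypothesis E3 : is_3graph E.

Definition tri (a b c : V) : bool := [set a; b; c] \in E.

(* [a] plays the vertex of [K4minus] that lies in all three edges. *)
Definition cop (a b c d : V) : bool := [&& tri a b c, tri a b d & tri a c d].

Lemma tri_swap12 a b c : tri a b c = tri b a c.
Proof. by rewrite /tri (setUC [set a]). Qed.

Lemma tri_swap23 a b c : tri a b c = tri a c b.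
Proof. by rewrite /tri -!setUA (setUC [set b]). Qed.

Lemma tri_uniq a b c : tri a b c -> uniq [:: a; b; c].
Proof.
move=> /E3 h3; apply/card_uniqP => /=; rewrite -h3; apply: eq_card => x.
by rewrite !inE orbA.
Qed.

Lemma cop_uniq a b c d : cop a b c d -> uniq [:: a; b; c; d].
Proof.
case/and3P=> /tri_uniq h1 /tri_uniq h2 /tri_uniq h3; move: h1 h2 h3.
rewrite /= !inE !negb_or !andbT.
by case/andP=> /andP[-> ->] -> /andP[/andP[_ ->] ->] /andP[_ ->].
Qed.

Definition ent4 (w : V * V * V * V) : seq V :=
  [:: w.1.1.1; w.1.1.2; w.1.2; w.2].

Definition cop4 (w : V * V * V * V) : bool := cop w.1.1.1 w.1.1.2 w.1.2 w.2.

(* Tilings of a multiset, so that gluing tilings needs no disjointness;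
   distinctness is recovered only once the multiset is the whole vertex set. *)
Definition tiled (s : seq V) : Prop :=
  exists2 l : seq (V * V * V * V), all cop4 l & perm_eq (flatten (map ent4 l)) s.

Lemma tiled_perm s s' : perm_eq s s' -> tiled s -> tiled s'.
Proof. by move=> ss' [l hl ls]; exists l => //; apply: perm_trans ss'. Qed.

Lemma tiled_nil : tiled [::].
Proof. by exists [::]. Qed.

Lemma tiled_cat s s' : tiled s -> tiled s' -> tiled (s ++ s').
Proof.
move=> [l hl ls] [l' hl' ls']; exists (l ++ l'); first by rewrite all_cat hl.
by rewrite map_cat flatten_cat perm_cat.
Qed.

Lemma tiled_cop a b c d : cop a b c d -> tiled [:: a; b; c; d].
Proof. by move=> h; exists [:: (a, b, c, d)]; rewrite /= ?andbT. Qed.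

Lemma tiled_size s : tiled s -> (4 %| size s)%N.
Proof.
case=> l _ /perm_size <-; rewrite size_flatten /shape -map_comp.
by elim: l => //= x l IH; rewrite dvdn_addr.
Qed.

Lemma cop4_is_copy w : cop4 w ->
  exists f : 'I_4 -> V, is_copy K4minus E f /\
    [set x in ent4 w] = f @: [set: 'I_4].
Proof.
move=> hw; have un := cop_uniq hw; case/and3P: (hw) => h1 h2 h3.
pose f (i : 'I_4) := nth w.2 (ent4 w) i.
have finj : injective f.
  by move=> i j /eqP; rewrite nth_uniq // => /eqP/val_inj.
exists f; split; last first.
  apply/setP=> x; rewrite inE; apply/idP/imsetP.
    by move=> /(nthP w.2)[i hi <-]; exists (Ordinal (hi : (i < 4)%N)).
  by case=> i _ ->; apply: mem_nth.
split=> // e; rewrite inE => /andP[/eqP e3 e0].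
(* A triple of ['I_4] is the complement of one vertex [j]; containing [ord0] rules out [j = 0] and
   leaves the three edges. *)
have [j ej] : exists j, e = [set~ j].
  have /cards1P[j hj] : #|~: e| == 1%N by rewrite cardsCs setCK card_ord e3.
  by exists j; rewrite -hj setCK.
have fe x y z : e = [set x; y; z] -> f @: e = [set f x; f y; f z].
  by move=> ->; rewrite !imsetU !imset_set1.
have o0 : ord0 = @Ordinal 4 0 isT by apply: val_inj.
case: j ej => -[|[|[|[|//]]]] hj ej.
- by move: e0; rewrite ej !inE.
- rewrite (fe (@Ordinal 4 0 isT) (@Ordinal 4 2 isT) (@Ordinal 4 3 isT)) //.
  by rewrite ej; apply/setP=> -[[|[|[|[|//]]]] hi]; rewrite !inE.
- rewrite (fe (@Ordinal 4 0 isT) (@Ordinal 4 1 isT) (@Ordinal 4 3 isT)) //.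
  by rewrite ej; apply/setP=> -[[|[|[|[|//]]]] hi]; rewrite !inE.
- rewrite (fe (@Ordinal 4 0 isT) (@Ordinal 4 1 isT) (@Ordinal 4 2 isT)) //.
  by rewrite ej; apply/setP=> -[[|[|[|[|//]]]] hi]; rewrite !inE.
Qed.

(** [enum V] is duplicate-free, hence so is the flattened tiling, and distinct blocks are
    disjoint. *)
Lemma tiled_factor : tiled (enum V) -> has_factor K4minus E.
Proof.
case=> l hl pl; exists [set [set x in ent4 w] | w in l]; split; last first.
  by move=> S /imsetP[w wl ->]; apply: cop4_is_copy; exact: (allP hl).
have un : uniq (flatten (map ent4 l)) by rewrite (perm_uniq pl) enum_uniq.
apply/and3P; split.
- apply/eqP/setP=> x; rewrite [RHS]inE; apply/bigcupP.
  have : x \in flatten (map ent4 l) by rewrite (perm_mem pl) mem_enum.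
  case/flattenP=> s /mapP[w wl ->] xw; exists [set x in ent4 w]; last by rewrite inE.
  exact: imset_f.
- apply/trivIsetP => A B /imsetP[w wl ->] /imsetP[w' wl' ->] ne.
  have {}ne : w != w' by apply: contraNN ne => /eqP->.
  rewrite -setI_eq0; apply/eqP/setP=> x; rewrite !inE; apply/negbTE/negP.
  case/andP=> xw xw'.
  have : uniq (ent4 w ++ flatten (map ent4 (rem w l))).
    have := perm_uniq (perm_flatten (perm_map ent4 (perm_to_rem wl))).
    by rewrite un => /esym.
  rewrite cat_uniq => /and3P[_ /hasPn h _].
  have xl : x \in flatten (map ent4 (rem w l)).
    have w'r : w' \in rem w l.
      by move: wl'; rewrite (perm_mem (perm_to_rem wl)) inE eq_sym (negbTE ne).
    by apply/flattenP; exists (ent4 w'); [exact: (map_f _ w'r)|rewrite !inE].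
  by move: (h x xl); rewrite !inE xw.
- apply/negP=> /imsetP[w wl] /setP/(_ w.2).
  by rewrite !inE eqxx !orbT.
Qed.

(** Remove a copy inside [X] while there is one; strong induction on the size. *)
Lemma tiled_greedy (X : seq V) : uniq X ->
  exists2 W : seq V, exists2 U, tiled U & perm_eq (U ++ W) X &
    forall a b c d, a \in W -> b \in W -> c \in W -> d \in W -> ~~ cop a b c d.
Proof.
have [m] := ubnP (size X); elim: m X => // m IH X; rewrite ltnS => sX uX.
pose C (w : V * V * V * V) := all (mem X) (ent4 w) && cop4 w.
case: (pickP C) => [w /andP[/allP wX cw]|noC]; last first.
  exists X; first by exists [::]; [exact: tiled_nil|].
  move=> a b c d aX bX cX dX; apply/negP=> h; have := noC (a, b, c, d).
  by rewrite /C /= aX bX cX dX /cop4 h.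
have uw : uniq (ent4 w) := cop_uniq cw.
pose Y := [seq x <- X | x \notin ent4 w].
have pY : perm_eq (ent4 w ++ Y) X.
  apply: uniq_perm => //.
    rewrite cat_uniq uw filter_uniq // andbT /=.
    by apply/hasPn=> x; rewrite mem_filter => /andP[].
  move=> x; rewrite mem_cat mem_filter; case: (boolP (x \in ent4 w)) => //=.
  by move=> /wX.
have [||W [U tU pU] hW] := IH Y.
- by move: (perm_size pY) sX; rewrite size_cat /=; lia.
- exact: filter_uniq.
exists W => //; exists (ent4 w ++ U); first exact/tiled_cat/tU/tiled_cop.
by apply: perm_trans pY; rewrite -catA perm_cat2l.
Qed.

(** Beside [s], the vertices [q] and [w] are interchangeable. The apex lies in [s]: the condition
    says that [s] is an edge and that two pairs through [s.1.1] lie in both links. *)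
Definition gad (q w : V) (s : V * V * V) : bool :=
  cop s.1.1 q s.1.2 s.2 && cop s.1.1 w s.1.2 s.2.

Definition ent3 (s : V * V * V) : seq V := [:: s.1.1; s.1.2; s.2].

Local Notation T :=
  (((V * V * V * V) * (V * V * V) * (V * V * V) * (V * V * V) * (V * V * V))%type).

Definition entA (A : T) : seq V :=
  ent4 A.1.1.1.1 ++ ent3 A.1.1.1.2 ++ ent3 A.1.1.2 ++ ent3 A.1.2 ++ ent3 A.2.

Definition absorbs (A : T) (q : V * V * V * V) : bool :=
  let: (w, s1, s2, s3, s4) := A in
  [&& cop4 w, gad q.1.1.1 w.1.1.1 s1, gad q.1.1.2 w.1.1.2 s2,
   gad q.1.2 w.1.2 s3 & gad q.2 w.2 s4].

Lemma absorbs_tiled A q : absorbs A q -> tiled (entA A).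
Proof.
case: A => [[[[w s1] s2] s3] s4]; case/and5P.
move=> _ /andP[_ h1] /andP[_ h2] /andP[_ h3] /andP[_ h4].
have := tiled_cat (tiled_cop h1) (tiled_cat (tiled_cop h2) (tiled_cat (tiled_cop h3) (tiled_cop h4))).
(* Equality of multisets is checked on counts, where it is a linear identity. *)
by apply: tiled_perm; apply/permP => P /=; ring.
Qed.

Lemma absorbs_tiled_cat A q : absorbs A q -> tiled (entA A ++ ent4 q).
Proof.
case: A => [[[[w s1] s2] s3] s4]; case/and5P.
move=> h0 /andP[h1 _] /andP[h2 _] /andP[h3 _] /andP[h4 _].
have := tiled_cat (tiled_cop h0) (tiled_cat (tiled_cop h1)
  (tiled_cat (tiled_cop h2) (tiled_cat (tiled_cop h3) (tiled_cop h4)))).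
by apply: tiled_perm; apply/permP => P /=; ring.
Qed.

(** Four vertices of [W] at a time are given to a member of [F] absorbing them. Deleting that member
    lowers every count by at most one, so [m] rounds are possible; members left at the end are tiled
    on their own. *)
Lemma absorb_all (m : nat) (F : seq T) (W : seq V) :
  (forall A, A \in F -> exists q, absorbs A q) ->
  (forall q, (m <= count (absorbs^~ q) F)%N) ->
  size W = (4 * m)%N ->
  tiled (flatten (map entA F) ++ W).
Proof.
elim: m F W => [|m IH] F W hF hm sW.
  have -> : W = [::] by apply/size0nil; rewrite sW.
  rewrite cats0; elim: F hF {hm} => [_|A F IHF hF] /=; first exact: tiled_nil.
  have [q hq] := hF A (mem_head _ _).
  apply/(tiled_cat (absorbs_tiled hq))/IHF => B hB.
  by apply: hF; rewrite inE hB orbT.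
case: W sW => [|q1 [|q2 [|q3 [|q4 W]]]] /= sW; try lia.
pose q := (q1, q2, q3, q4).
have /hasP[A AF Aq] : has (absorbs^~ q) F by rewrite has_count; have := hm q; lia.
have pF := perm_to_rem AF.
have tl : tiled (flatten (map entA (rem A F)) ++ W).
  apply: IH; last by lia.
  - by move=> B /mem_rem; apply: hF.
  - move=> q'; have := hm q'; rewrite (permP pF) /=.
    by case: (absorbs A q') => /=; lia.
apply: tiled_perm (tiled_cat (absorbs_tiled_cat Aq) tl).
have p1 : perm_eq (flatten (map entA F)) (entA A ++ flatten (map entA (rem A F))).
  exact: perm_flatten (perm_map entA pF).
by apply/permP => P; rewrite !count_cat (permP p1) !count_cat /=; ring.
Qed.

End Tilings.

(** * Counting by sums of indicators *)

Section Sums.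
Variable R : realType.

Lemma card_natr (T : finType) (A : {pred T}) :
  #|A|%:R = \sum_x (x \in A)%:R :> R.
Proof.
rewrite -sum1_card natr_sum big_mkcond; apply: eq_bigr => x _.
by case: (x \in A).
Qed.

Lemma sum_triple (T1 T2 T3 : finType) (F : T1 * T2 * T3 -> R) :
  \sum_x F x = \sum_a \sum_b \sum_c F (a, b, c).
Proof. by rewrite 2!pair_bigA; apply: eq_bigr => -[[]]. Qed.

Lemma sum_quad (T1 T2 T3 T4 : finType) (F : T1 * T2 * T3 * T4 -> R) :
  \sum_x F x = \sum_a \sum_b \sum_c \sum_d F (a, b, c, d).
Proof. by rewrite 3!pair_bigA; apply: eq_bigr => -[[[]]]. Qed.

Lemma card_natr2 (T1 T2 : finType) (A : {pred T1 * T2}) :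
  #|A|%:R = \sum_a \sum_b ((a, b) \in A)%:R :> R.
Proof. by rewrite card_natr pair_bigA; apply: eq_bigr => -[]. Qed.

(** Lower bounds for successive choices multiply; this builds absorbers piece by piece. *)
Lemma sum_pair_ge (X Y : finType) (P : pred X) (Q : X -> pred Y) (m1 m2 : R) :
  0 <= m2 -> m1 <= \sum_x (P x)%:R ->
  (forall x, P x -> m2 <= \sum_y (Q x y)%:R) ->
  m1 * m2 <= \sum_(z : X * Y) (P z.1 && Q z.1 z.2)%:R.
Proof.
move=> m2_ge0 hP hQ.
rewrite -(pair_bigA _ (fun x y => (P x && Q x y)%:R)) /=.
apply: (le_trans (ler_wpM2r m2_ge0 hP)); rewrite mulr_suml; apply: ler_sum => x _.
case: (boolP (P x)) => Px; first by rewrite mul1r; exact: hQ.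
by rewrite mul0r; apply: sumr_ge0 => y _; exact: ler0n.
Qed.

(** Union bound over the three coordinates that may fall into [U]. *)
Lemma sum_avoid (T : finType) (P : T * T * T -> bool) (U : {pred T}) :
  \sum_s (P s)%:R - 3 * #|U|%:R * #|T|%:R ^+ 2 <=
  \sum_s (P s && all (fun x => x \notin U) (ent3 s))%:R :> R.
Proof.
have k (x : R) : \sum_(y : T) x = x * #|T|%:R by rewrite sumr_const mulr_natr.
have e : \sum_(s : T * T * T) ((s.1.1 \in U)%:R + (s.1.2 \in U)%:R + (s.2 \in U)%:R)
   = 3 * #|U|%:R * #|T|%:R ^+ 2 :> R.
  rewrite !big_split !sum_triple /= card_natr.
  under [in X in X + _ + _]eq_bigr do (under eq_bigr do rewrite k; rewrite k).
  under [in X in _ + X + _]eq_bigr do (under eq_bigr do rewrite k; rewrite -mulr_suml).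
  rewrite -!mulr_suml !k; ring.
rewrite lerBlDr -e -big_split /=; apply: ler_sum => -[[a b] c] _ /=.
case: (P _) => /=; last by rewrite add0r -!natrD ler0n.
by case: (a \in U); case: (b \in U); case: (c \in U) => /=; lra.
Qed.

End Sums.

(** * Counting copies by cherry-density *)

Section Counting.
Variables (R : realType) (n : nat) (E : {set {set 'I_n}}) (p mu : R).
Hypothesis hE : cherry_dense p mu E.

(** Cherry-density with the middle vertex [a] of the cherry summed outermost; [P] therefore enters
    transposed. *)
Lemma cherry_sum (P Q : 'I_n -> 'I_n -> bool) :
  p * (\sum_a \sum_b \sum_c (P a b && Q a c)%:R) - mu * n%:R ^+ 3 <=
  \sum_a \sum_b \sum_c (P a b && Q a c && tri E a b c)%:R.
Proof.
have := hE [set x | P x.2 x.1] [set x | Q x.1 x.2].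
rewrite !card_natr !sum_triple => h.
rewrite [X in p * X]exchange_big [leRHS]exchange_big; move: h; congr (p * _ - _ <= _).
  by do 3 (apply: eq_bigr => ? _); rewrite /Echerry /Kcherry !inE.
by do 3 (apply: eq_bigr => ? _); rewrite tri_swap12 /Echerry /Kcherry !inE.
Qed.

Lemma cherry_sum_fixing (I : finType) (P Q : I -> 'I_n -> 'I_n -> bool) :
  p * (\sum_i \sum_a \sum_b \sum_c (P i a b && Q i a c)%:R) - mu * #|I|%:R * n%:R ^+ 3 <=
  \sum_i \sum_a \sum_b \sum_c (P i a b && Q i a c && tri E a b c)%:R.
Proof.
have -> : mu * #|I|%:R * n%:R ^+ 3 = \sum_(i : I) mu * n%:R ^+ 3.
  by rewrite sumr_const -mulr_natr; ring.
rewrite mulr_sumr -sumrB; apply: ler_sum => i _; exact: cherry_sum.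
Qed.

(** The edges [abc], [abd], [acd] are imposed one by one, each time fixing the vertex outside the
    new edge. Every earlier condition then involves at most one of the two leaves of the cherry
    centred at [a], so cherry-density applies and costs a factor [p] and an error [mu * n ^ 4]. *)
Lemma copy_count (X1 X2 X3 X4 : {set 'I_n}) : 0 <= p <= 1 -> 0 <= mu ->
  p ^+ 3 * (#|X1|%:R * #|X2|%:R * #|X3|%:R * #|X4|%:R) - 3 * mu * n%:R ^+ 4 <=
  \sum_w ([&& w.1.1.1 \in X1, w.1.1.2 \in X2, w.1.2 \in X3, w.2 \in X4 & cop4 E w])%:R.
Proof.
move=> /andP[p0 p1] mu0; rewrite sum_quad /=.
pose S (f : 'I_n -> 'I_n -> 'I_n -> 'I_n -> bool) : R :=
  \sum_a \sum_b \sum_c \sum_d (f a b c d)%:R.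
(* Reorderings that put the vertex to be fixed outermost. *)
have S_d f : S f = \sum_d \sum_a \sum_b \sum_c (f a b c d)%:R.
  rewrite /S; under eq_bigr do under eq_bigr do rewrite exchange_big.
  by under eq_bigr do rewrite exchange_big; rewrite exchange_big.
have S_c f : S f = \sum_c \sum_a \sum_b \sum_d (f a b c d)%:R.
  by rewrite /S; under eq_bigr do rewrite exchange_big; rewrite exchange_big.
have S_b f : S f = \sum_b \sum_a \sum_c \sum_d (f a b c d)%:R.
  by rewrite /S exchange_big.
pose x a b c d := [&& a \in X1, b \in X2, c \in X3 & d \in X4].
have Sx : S x = #|X1|%:R * #|X2|%:R * #|X3|%:R * #|X4|%:R.
  rewrite /S !card_natr; under eq_bigr => a _.
    under eq_bigr => b _.
      under eq_bigr => c _.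
        under eq_bigr => d _.
          rewrite (_ : (x a b c d)%:R =
            (a \in X1)%:R * (b \in X2)%:R * (c \in X3)%:R * (d \in X4)%:R :> R); last first.
            by rewrite /x; do 4 case: (_ \in _); rewrite /= ?mulr0 ?mul0r ?mul1r.
          over.
        rewrite -mulr_sumr; over.
      rewrite -mulr_suml -mulr_sumr; over.
    rewrite -!mulr_suml -mulr_sumr; over.
  by rewrite -!mulr_suml.
have cM : mu * #|'I_n|%:R * n%:R ^+ 3 = mu * n%:R ^+ 4 by rewrite card_ord; ring.
pose x1 a b c d := x a b c d && tri E a b c.
pose x2 a b c d := x1 a b c d && tri E a b d.
have h1 : p * S x - mu * n%:R ^+ 4 <= S x1.
  have := cherry_sum_fixing (fun d a b => (a \in X1) && (b \in X2)) (fun d a c => (c \in X3) && (d \in X4)).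
  rewrite cM !S_d; congr (p * _ - _ <= _).
    by do 4 (apply: eq_bigr => ? _); rewrite -andbA.
  by do 4 (apply: eq_bigr => ? _); rewrite /x1 /x !andbA.
have h2 : p * S x1 - mu * n%:R ^+ 4 <= S x2.
  have := cherry_sum_fixing (fun c a b => [&& a \in X1, b \in X2, c \in X3 & tri E a b c])
    (fun c a d => d \in X4).
  rewrite cM !S_c; congr (p * _ - _ <= _); do 4 (apply: eq_bigr => ? _).
    congr (nat_of_bool _)%:R; rewrite /x1 /x; do 4 case: (_ \in _) => //=; try by rewrite ?andbF ?andbT.
  congr (nat_of_bool _)%:R; rewrite /x2 /x1 /x; do 4 case: (_ \in _) => //=; try by rewrite ?andbF ?andbT.
have h3 : p * S x2 - mu * n%:R ^+ 4 <= 
   S (fun a b c d => [&& a \in X1, b \in X2, c \in X3, d \in X4 & cop4 E (a, b, c, d)]).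
  have := cherry_sum_fixing (fun b a c => [&& a \in X1, b \in X2, c \in X3 & tri E a b c])
    (fun b a d => (d \in X4) && tri E a b d).
  rewrite cM !S_b; congr (p * _ - _ <= _); do 4 (apply: eq_bigr => ? _).
    congr (nat_of_bool _)%:R; rewrite /x2 /x1 /x; do 4 case: (_ \in _) => //=; try by rewrite ?andbF ?andbT.
  congr (nat_of_bool _)%:R; rewrite /cop4 /cop /=; do 4 case: (_ \in _) => //=; try by rewrite ?andbF ?andbT ?andbA.
(* Since [p <= 1], the earlier errors do not grow under multiplication by [p], and the three add up
   to at most [3 * mu * n ^ 4]. *)
have {Sx}h4 : p ^+ 3 * (#|X1|%:R * #|X2|%:R * #|X3|%:R * #|X4|%:R) - 3 * mu * n%:R ^+ 4 <= 
  p * (p * (p * S x - mu * n%:R ^+ 4) - mu * n%:R ^+ 4) - mu * n%:R ^+ 4.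
  rewrite Sx; have N0 : 0 <= mu * n%:R ^+ 4 by rewrite mulr_ge0 ?exprn_ge0.
  move: N0; set N := mu * n%:R ^+ 4; set Z := _ * #|X4|%:R => N0.
  have : p * N <= N by rewrite ler_piMl.
  have : p * (p * N) <= N.
    apply: le_trans (_ : p * N <= N); last by rewrite ler_piMl.
    by apply: ler_wpM2l => //; rewrite ler_piMl.
  rewrite -mulrA -/N; nra.
apply: le_trans h4 _. apply: le_trans h3; rewrite lerD2r ler_wpM2l //.
by apply: le_trans h2; rewrite lerD2r ler_wpM2l.
Qed.

End Counting.

(** * Links, partners and gadgets *)

Definition link (V : finType) (E : {set {set V}}) (v : V) : {set V * V} :=
  [set x | tri E v x.1 x.2].

(** Adding [v] to the ordered pairs of the link reaches every edge at [v]. *)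
Lemma deg_le_link (V : finType) (E : {set {set V}}) (v : V) :
  is_3graph E -> (deg E v <= #|link E v|)%N.
Proof.
move=> E3; rewrite /deg.
apply: leq_trans (leq_imset_card (fun x : V * V => [set v; x.1; x.2]) _).
apply/subset_leq_card/subsetP=> e; rewrite inE => /andP[eE ve].
have : #|e :\ v| == 2%N by rewrite -eqSS -(E3 _ eE) (cardsD1 v e) ve.
case/cards2P=> x [y [_ exy]]; have ee : e = [set v; x; y].
  by rewrite -setUA -exy setD1K.
by apply/imsetP; exists (x, y) => //=; rewrite inE /tri /= -ee.
Qed.

Section Gadgets.
Variables (R : realType) (n : nat) (E : {set {set 'I_n}}) (p mu : R).
Hypothesis hE : cherry_dense p mu E.

(** Cherry-density with the link of [q] on one side and all pairs on the other: an edge [abw] puts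
    the pair [ab] into the link of [w]. *)
Lemma sum_common_link (q : 'I_n) :
  p * #|link E q|%:R * n%:R - mu * n%:R ^+ 3 <=
  \sum_w #|link E q :&: link E w|%:R.
Proof.
have := cherry_sum hE (fun a b => (a, b) \in link E q) (fun _ _ => true).
rewrite -mulrA; congr (p * _ - _ <= _).
  rewrite card_natr2 mulr_suml; apply: eq_bigr => a _; rewrite mulr_suml; apply: eq_bigr => b _.
  by rewrite sumr_const card_ord andbT mulr_natr.
under eq_bigr do rewrite exchange_big.
rewrite exchange_big; apply: eq_bigr => w _.
rewrite card_natr2.
do 2 (apply: eq_bigr => ? _).
by rewrite !inE /= andbT (tri_swap12 _ w) (tri_swap23 _ _ w).
Qed.

Definition partners (g : R) (q : 'I_n) : {set 'I_n} :=
  [set w | g * n%:R ^+ 2 <= #|link E q :&: link E w|%:R].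

(** The common links have total size at least [p * alpha / 2 * n ^ 3]. Non-partners account for at
    most half of this, and each partner for at most [n ^ 2]. *)
Lemma partners_large (alpha : R) (q : 'I_n) : 0 < p -> 0 < alpha ->
  mu <= p * alpha / 2 -> alpha * n%:R ^+ 2 <= #|link E q|%:R ->
  p * alpha / 4 * n%:R <= #|partners (p * alpha / 4) q|%:R.
Proof.
move=> p0 a0 hmu hq; set g := p * alpha / 4.
have n0 : 0 < n%:R :> R by rewrite ltr0n (leq_ltn_trans _ (ltn_ord q)).
have h1 := sum_common_link q.
have h2 : \sum_w #|link E q :&: link E w|%:R <=
    #|partners g q|%:R * n%:R ^+ 2 + g * n%:R ^+ 3 :> R.
  have -> : g * n%:R ^+ 3 = \sum_(w < n) g * n%:R ^+ 2.
    by rewrite sumr_const card_ord -mulr_natr; ring.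
  rewrite card_natr mulr_suml -big_split /=; apply: ler_sum => w _.
  have : #|link E q :&: link E w|%:R <= n%:R ^+ 2 :> R.
    by rewrite -natrX ler_nat (leq_trans (max_card _)) // card_prod card_ord.
  have g_n : 0 <= g * n%:R ^+ 2 by rewrite mulr_ge0 ?exprn_ge0 // divr_ge0 // mulr_ge0 ?ltW.
  move=> hn; rewrite inE; case: (leP (g * _)) => hw /=; first by rewrite mul1r; lra.
  by rewrite mul0r add0r ltW.
have h3 : p * (alpha * n%:R ^+ 2) * n%:R <= p * #|link E q|%:R * n%:R.
  by rewrite ler_pM2r // ler_pM2l.
have h4 : mu * n%:R ^+ 3 <= p * alpha / 2 * n%:R ^+ 3 by rewrite ler_wpM2r ?exprn_ge0.
rewrite -(ler_pM2r (exprn_gt0 2 n0)) -mulrA -exprS.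
have e : p * (alpha * n%:R ^+ 2) * n%:R = p * alpha * n%:R ^+ 3 by ring.
rewrite /g in h2 *; lra.
Qed.

(** A gadget is a cherry in the common link [C] whose three vertices form an edge of [E]. Cherries
    number at least [g ^ 2 * n ^ 3] by convexity. *)
Lemma gad_count (g : R) (q w : 'I_n) : 0 <= p -> 0 <= g -> w \in partners g q ->
  (p * g ^+ 2 - mu) * n%:R ^+ 3 <= \sum_s (gad E q w s)%:R.
Proof.
move=> p0 g0; rewrite inE; set C := link E q :&: link E w => hC.
have n0 : 0 < n%:R :> R by rewrite ltr0n (leq_ltn_trans _ (ltn_ord q)).
pose N (a : 'I_n) : R := \sum_b ((a, b) \in C)%:R.
have sN : \sum_a N a = #|C|%:R.
  by rewrite card_natr2.
have := cherry_sum hE (fun a b => (a, b) \in C) (fun a b => (a, b) \in C).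
rewrite (_ : \sum_a \sum_b \sum_c _ = \sum_a N a ^+ 2); last first.
  apply: eq_bigr => a _; rewrite expr2 mulr_suml; apply: eq_bigr => b _.
  by rewrite mulr_sumr; apply: eq_bigr => c _; rewrite -natrM mulnb.
rewrite (_ : \sum_a \sum_b \sum_c _ = \sum_s (gad E q w s)%:R); last first.
  rewrite sum_triple; do 3 (apply: eq_bigr => ? _).
  rewrite /gad /cop !inE /= !(tri_swap12 _ q) !(tri_swap12 _ w).
  by congr (nat_of_bool _)%:R; do 4 case: (tri E _ q _) => //=; do 4 case: (tri E _ w _) => //=; rewrite ?andbF ?andbb.
apply: le_trans; rewrite mulrBl lerD2r -mulrA ler_wpM2l //.
(* Cauchy-Schwarz in tangent form, [x ^ 2 >= 2 * t * x - t ^ 2] at [t = g * n], a lower bound for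
   the average of [N]. *)
have : \sum_a (2 * (g * n%:R) * N a - (g * n%:R) ^+ 2) <= \sum_a N a ^+ 2.
  by apply: ler_sum => a _; have := sqr_ge0 (N a - g * n%:R); rewrite sqrrB; lra.
rewrite sumrB -mulr_sumr sN sumr_const card_ord -[(_ ^+ 2) *+ n]mulr_natr.
have : g * n%:R ^+ 2 * (g * n%:R) <= #|C|%:R * (g * n%:R).
  by rewrite ler_wpM2r // mulr_ge0 // ltW.
have -> : g * n%:R ^+ 2 * (g * n%:R) = g ^+ 2 * n%:R ^+ 3 by ring.
have -> : (g * n%:R) ^+ 2 * n%:R = g ^+ 2 * n%:R ^+ 3 by ring.
have -> : 2 * (g * n%:R) * #|C|%:R = 2 * (#|C|%:R * (g * n%:R)) by ring.
move: (#|C|%:R * _) (g ^+ 2 * _) (\sum_a _) => x y z; lra.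
Qed.

End Gadgets.

(** * Counting absorbers and choosing a disjoint family *)

Lemma ler_bool (R : realType) (a b : bool) : (a -> b) -> a%:R <= b%:R :> R.
Proof. by case: a b => [] [] h; rewrite ler_nat //; move: (h isT). Qed.

Lemma card_seq_setU (V : finType) (U : {set V}) (s : seq V) :
  (#|U :|: [set x in s]| <= #|U| + size s)%N.
Proof.
apply: leq_trans (leq_card_setU _ _) _.
by rewrite leq_add2l cardsE card_size.
Qed.

(** Choose [w], then the four triples in turn, each avoiding [U] and all vertices chosen before.
    These are at most 13, within the allowance of 16. *)
Lemma absorbs_count (R : realType) (V : finType) (E : {set {set V}})
  (X : V -> {set V}) (U : {set V}) (m1 m2 : R) (q : V * V * V * V) :
  is_3graph E -> 0 <= m2 ->
  m1 <= \sum_w [&& w.1.1.1 \in X q.1.1.1 :\: U, w.1.1.2 \in X q.1.1.2 :\: U,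
                   w.1.2 \in X q.1.2 :\: U, w.2 \in X q.2 :\: U & cop4 E w]%:R ->
  (forall v w (U' : {set V}), w \in X v -> (#|U'| <= #|U| + 16)%N ->
     m2 <= \sum_s (gad E v w s && all (fun x => x \notin U') (ent3 s))%:R) ->
  m1 * m2 ^+ 4 <=
  \sum_A [&& absorbs E A q, uniq (entA A) & all (fun x => x \notin U) (entA A)]%:R.
Proof.
move=> E3 m20 h1 h2.
pose ext v w (l : seq V) s := gad E v w s && all (fun x => x \notin U :|: [set x in l]) (ent3 s).
have hext v w l : w \in X v -> (size l <= 16)%N -> m2 <= \sum_s (ext v w l s)%:R.
  move=> hw hl; apply: h2 => //; apply: leq_trans (card_seq_setU _ _) _.
  by rewrite leq_add2l.
have extP v w l s : ext v w l s -> uniq l -> all (fun x => x \notin U) l ->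
    uniq (l ++ ent3 s) && all (fun x => x \notin U) (l ++ ent3 s).
  case/andP=> /andP[/and3P[_ _ /(tri_uniq E3) us] _] /allP hs ul aU.
  rewrite cat_uniq ul us all_cat aU andbT !andTb.
  apply/andP; split.
    by apply/hasPn=> x /hs; rewrite !inE negb_or => /andP[].
  by apply/allP=> x /hs; rewrite !inE negb_or => /andP[].
pose P0 := fun w => [&& w.1.1.1 \in X q.1.1.1 :\: U, w.1.1.2 \in X q.1.1.2 :\: U,
                   w.1.2 \in X q.1.2 :\: U, w.2 \in X q.2 :\: U & cop4 E w].
pose Q1 := fun w s => ext q.1.1.1 w.1.1.1 (ent4 w) s.
pose P1 := fun z => P0 z.1 && Q1 z.1 z.2.
have k1 : m1 * m2 <= \sum_z (P1 z)%:R.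
  apply: (@sum_pair_ge R _ _ P0 Q1 m1 m2 m20 h1) => w /and5P[].
  by rewrite inE => /andP[_ hw] _ _ _ _; apply: hext.
pose Q2 := fun z s => ext q.1.1.2 z.1.1.1.2 (ent4 z.1 ++ ent3 z.2) s.
pose P2 := fun z => P1 z.1 && Q2 z.1 z.2.
have k2 : m1 * m2 * m2 <= \sum_z (P2 z)%:R.
  apply: (@sum_pair_ge R _ _ P1 Q2 _ m2 m20 k1) => -[w s1] /andP[/and5P[_ +] _].
  by rewrite inE => /andP[_ hw] _ _ _; apply: hext.
pose Q3 := fun z s => ext q.1.2 z.1.1.1.2 ((ent4 z.1.1 ++ ent3 z.1.2) ++ ent3 z.2) s.
pose P3 := fun z => P2 z.1 && Q3 z.1 z.2.
have k3 : m1 * m2 * m2 * m2 <= \sum_z (P3 z)%:R.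
  apply: (@sum_pair_ge R _ _ P2 Q3 _ m2 m20 k2) => -[[w s1] s2] /andP[/andP[/and5P[_ _ +] _] _].
  by rewrite inE => /andP[_ hw] _ _; apply: hext.
pose Q4 := fun z s => ext q.2 z.1.1.1.2 (((ent4 z.1.1.1 ++ ent3 z.1.1.2) ++ ent3 z.1.2) ++ ent3 z.2) s.
pose P4 := fun z => P3 z.1 && Q4 z.1 z.2.
have k4 : m1 * m2 * m2 * m2 * m2 <= \sum_z (P4 z)%:R.
  apply: (@sum_pair_ge R _ _ P3 Q4 _ m2 m20 k3) => -[[[w s1] s2] s3] /andP[/andP[/andP[/and5P[_ _ _ +] _] _] _].
  by rewrite inE => /andP[_ hw] _; apply: hext.
have -> : m1 * m2 ^+ 4 = m1 * m2 * m2 * m2 * m2 by ring.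
apply: le_trans k4 _; apply: ler_sum => -[[[[w s1] s2] s3] s4] _; apply: ler_bool.
case/andP=> /andP[/andP[/andP[]]] /and5P[/= i1 i2 i3 i4 hw] e1 e2 e3 e4.
have uw : uniq (ent4 w) := cop_uniq E3 hw.
have aw : all (fun x => x \notin U) (ent4 w).
  by move: i1 i2 i3 i4; rewrite !inE /= => /andP[-> _] /andP[-> _] /andP[-> _] /andP[-> _].
have /andP[u1 a1] := extP _ _ _ _ e1 uw aw.
have /andP[u2 a2] := extP _ _ _ _ e2 u1 a1.
have /andP[u3 a3] := extP _ _ _ _ e3 u2 a2.
have /andP[u4 a4] := extP _ _ _ _ e4 u3 a3.
apply/and3P; split; [rewrite /absorbs hw|exact: u4|exact: a4].
by case/andP: e1 => -> _; case/andP: e2 => -> _; case/andP: e3 => -> _; case/andP: e4 => -> _.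
Qed.

Lemma exists_ge_average (R : realType) (T : finType) (f : T -> R) (m : R) :
  (0 < #|T|)%N -> m * #|T|%:R <= \sum_x f x -> exists x, m <= f x.
Proof.
move=> T0; case: (boolP [exists x, m <= f x]) => [/existsP //|/existsPn h].
have [x0 _] : exists x0 : T, true by case/card_gt0P: T0 => x _; exists x.
rewrite leNgt => /negP[]; rewrite mulr_natr -sumr_const.
rewrite (bigD1 x0) //= [ltRHS](bigD1 x0) //=; apply: ltr_leD.
  by rewrite ltNge h.
by apply: ler_sum => x _; rewrite ltW // ltNge h.
Qed.

(* The potential [\sum_q 2 ^- X_q], where [X_q] counts the members of [F]
   absorbing [q], drops by a constant factor at each step when the next member
   is chosen by averaging: this replaces the random choice of [F]. *)
Lemma greedy_family (R : realType) (V T Q : finType) (ab : T -> Q -> bool)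
  (ent : T -> seq V) (beta : R) (k t : nat) :
  0 < beta < 1 -> (0 < #|T|)%N -> (0 < #|Q|)%N -> (forall A, size (ent A) = k) ->
  (forall (U : {set V}) q, (#|U| <= k * t)%N -> beta * #|T|%:R <=
     \sum_A [&& ab A q, uniq (ent A) & all (fun x => x \notin U) (ent A)]%:R) ->
  exists F : seq T, [/\ size F = t, uniq (flatten (map ent F)),
    forall A, A \in F -> exists q, ab A q &
    \sum_q 2^-1 ^+ count (ab^~ q) F <= #|Q|%:R * (1 - beta / 2) ^+ t].
Proof.
move=> /andP[b0 b1] T0 Q0 szk hcount.
suff H i : (i <= t)%N -> exists F : seq T, [/\ size F = i, uniq (flatten (map ent F)),
    forall A, A \in F -> exists q, ab A q &
    \sum_q 2^-1 ^+ count (ab^~ q) F <= #|Q|%:R * (1 - beta / 2) ^+ i].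
  by have [F hF] := H t (leqnn t); exists F.
elim: i => [_|i IH hi].
  by exists [::]; split=> //; rewrite /= expr0 mulr1 card_natr.
have [F [sF uF hF phiF]] := IH (ltnW hi).
pose U := [set x in flatten (map ent F)].
have cU : (#|U| <= k * t)%N.
  rewrite cardsE (leq_trans (card_size _)) // size_flatten /shape -map_comp.
  rewrite (eq_map (g := fun=> k)); last by move=> A /=; rewrite szk.
  rewrite (_ : sumn _ = (k * i)%N) ?leq_mul2l ?(ltnW hi) ?orbT //.
  by rewrite -sF; elim: (F) => [|A F' IHF] /=; rewrite ?muln0 ?IHF ?mulnS.
pose ok A q := [&& ab A q, uniq (ent A) & all (fun x => x \notin U) (ent A)].
pose phi q : R := 2^-1 ^+ count (ab^~ q) F.
have phi_gt0 q : 0 < phi q by rewrite exprn_gt0 // invr_gt0.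
have Phi_gt0 : 0 < \sum_q phi q.
  have /card_gt0P[q0 _] := Q0; rewrite (bigD1 q0) //=.
  by rewrite ltr_pwDl // sumr_ge0 // => q _; exact: ltW.
have [A hA] : exists A, beta * (\sum_q phi q) <= \sum_q (ok A q)%:R * phi q.
  apply: exists_ge_average => //; rewrite exchange_big /= mulrAC mulr_sumr.
  by apply: ler_sum => q _; rewrite -mulr_suml; apply: ler_wpM2r; [exact: ltW|exact: hcount].
(* The weighted sum is positive, so [A] absorbs something; in particular [A] is duplicate-free and
   avoids [U]. *)
have [q0 /and3P[abq uA aA]] : exists q, ok A q.
  apply/existsP; apply: contraTT hA => /existsPn h; rewrite -ltNge.
  rewrite big1 ?mulr_gt0 // => q _; by rewrite (negbTE (h q)) mul0r.
exists (A :: F); split.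
- by rewrite /= sF.
- rewrite /= cat_uniq uA uF andbT /=; apply/hasPn=> x xF.
  by apply: contraL xF => /(allP aA); rewrite inE.
- by move=> B; rewrite inE => /predU1P[->|/hF //]; exists q0.
(* The weight of each [q] absorbed by [A] is halved. *)
have step : \sum_q 2^-1 ^+ count (ab^~ q) (A :: F) <= \sum_q phi q - 2^-1 * \sum_q (ok A q)%:R * phi q.
  rewrite mulr_sumr -sumrB; apply: ler_sum => q _; rewrite /= exprD -/(phi q) /ok uA aA !andbT.
  by case: (ab A q) => /=; rewrite ?expr1 ?expr0; have := phi_gt0 q; lra.
apply: le_trans step _; rewrite exprSr mulrA.
have : (\sum_q phi q) * (1 - beta / 2) <= #|Q|%:R * (1 - beta / 2) ^+ i * (1 - beta / 2).
  by rewrite ler_wpM2r //; lra.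
by move: hA; lra.
Qed.

(** * Two numerical estimates *)

Lemma exists_expr_le_half (R : realType) (x : R) : 0 < x < 1 ->
  exists m : nat, (1 - x) ^+ m <= 2^-1.
Proof.
move=> /andP[x0 x1].
have bern k : (1 - x) ^+ k * (1 + k%:R * x) <= 1.
  elim: k => [|k IH]; first by rewrite expr0 mul0r addr0 mulr1.
  apply: le_trans IH; rewrite exprSr -mulrA; apply: ler_wpM2l.
    by rewrite exprn_ge0 // subr_ge0 ltW.
  rewrite -natr1; have : 0 <= x ^+ 2 * (k%:R + 1) by rewrite mulr_ge0 ?sqr_ge0 ?addr_ge0.
  by lra.
exists (Num.bound x^-1); set m := Num.bound _.
have hm : 1 <= m%:R * x.
  rewrite -ler_pdivrMr // mul1r ltW // archi_boundP // invr_ge0 ltW //.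
have := bern m; have : 0 <= (1 - x) ^+ m by rewrite exprn_ge0 // subr_ge0 ltW.
by move: (_ ^+ m) => y; nra.
Qed.

(** With [r = n %/ (8 * M)], the threshold gives [r >= 8 * M], so [n <= (r + 1) ^ 2] and
    [n ^ 4 <= (r + 1) ^ 8 <= 2 ^ (8 * r)]. *)
Lemma exp4_le_pow2_div (M : nat) : (0 < M)%N ->
  exists n0, forall n, (n0 <= n)%N -> (n ^ 4 <= 2 ^ (n %/ M))%N.
Proof.
move=> M0; exists (64 * M * M)%N => n hn.
pose r := (n %/ (8 * M))%N.
have hr : (8 * M <= r)%N by rewrite leq_divRL ?muln_gt0 //; nia.
have h1 : (n <= r.+1 ^ 2)%N.
  have : (n < r.+1 * (8 * M))%N by rewrite ltn_ceil // muln_gt0.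
  by rewrite -mulnn; nia.
have h2 : (r * 8 <= n %/ M)%N by rewrite leq_divRL // /r -mulnA leq_divM.
apply: leq_trans (leq_pexp2l _ h2) => //.
apply: (@leq_trans ((r.+1 ^ 2) ^ 4)%N); first by rewrite leq_exp2r.
by rewrite -expnM (expnM 2 r 8) leq_exp2r // ltn_expl.
Qed.

(** * Assembling the factor *)

Section Factor.
Variables (R : realType) (n : nat) (E : {set {set 'I_n}}) (p mu : R).
Hypothesis (hE : cherry_dense p mu E) (E3 : is_3graph E).

Lemma copy_free_small (W : seq 'I_n) : 0 <= p <= 1 -> 0 <= mu -> uniq W ->
  (forall a b c d, a \in W -> b \in W -> c \in W -> d \in W -> ~~ cop E a b c d) ->
  p ^+ 3 * (size W)%:R ^+ 4 <= 3 * mu * n%:R ^+ 4.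
Proof.
move=> p01 mu0 uW hW; pose X := [set x in W].
have := copy_count hE X X X X p01 mu0.
rewrite big1 => [|[[[a b] c] d] _]; last first.
  rewrite !inE /=; case: and5P => // -[aW bW cW dW].
  by rewrite /cop4 /= (negbTE (hW _ _ _ _ aW bW cW dW)).
have -> : #|X| = size W by rewrite cardsE; apply/card_uniqP.
by rewrite subr_le0; apply: le_trans; rewrite le_eqVlt; apply/orP; left; apply/eqP; ring.
Qed.

(** Outside [U] each vertex keeps [g / 2 * n] partners, and the bound on [mu] makes the error in
    [copy_count] at most half its main term. Of the at least [p * g ^ 2 / 2 * n ^ 3] gadget triples,
    avoidance destroys at most [p * g ^ 2 / 32 * n ^ 3]. *)
Lemma many_absorbers (g : R) (U : {set 'I_n}) (q : 'I_n * 'I_n * 'I_n * 'I_n) :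
  0 < p < 1 -> 0 < g < 1 -> 0 <= mu ->
  mu <= p ^+ 3 * (g / 2) ^+ 4 / 6 ->
  (forall v, g * n%:R <= #|partners E g v|%:R) ->
  96 * (#|U| + 16)%:R <= p * g ^+ 2 * n%:R ->
  p ^+ 3 * (g / 2) ^+ 4 / 2 * (p * g ^+ 2 / 4) ^+ 4 * n%:R ^+ 16 <=
  \sum_A [&& absorbs E A q, uniq (entA A) & all (fun x => x \notin U) (entA A)]%:R.
Proof.
move=> /andP[p0 p1] /andP[g0 g1] mu_ge0 mu_small partners_ge hU; set kappa := p ^+ 3 * (g / 2) ^+ 4 / 2.
have n0 : 0 <= n%:R :> R by [].
have pg : p * g ^+ 2 <= g.
  have : g ^+ 2 <= g by rewrite expr2 ler_piMl // ltW.
  by apply: le_trans; rewrite ler_piMl ?sqr_ge0 // ltW.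
have pg0 : 0 < p * g ^+ 2 by rewrite mulr_gt0 ?exprn_gt0.
have -> : kappa * (p * g ^+ 2 / 4) ^+ 4 * n%:R ^+ 16 =
   (kappa * n%:R ^+ 4) * (p * g ^+ 2 / 4 * n%:R ^+ 3) ^+ 4 by ring.
apply: (absorbs_count (X := partners E g)) => //.
- by rewrite mulr_ge0 ?exprn_ge0 // ltW // divr_gt0.
- apply: le_trans (copy_count hE (partners E g q.1.1.1 :\: U)
    (partners E g q.1.1.2 :\: U) (partners E g q.1.2 :\: U)
    (partners E g q.2 :\: U) _ mu_ge0).
    have hX v : g / 2 * n%:R <= #|partners E g v :\: U|%:R.
      have : #|partners E g v|%:R <= #|partners E g v :\: U|%:R + #|U|%:R :> R.
        rewrite -natrD ler_nat -(cardsID U (partners E g v)) addnC leq_add2l.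
        by rewrite subset_leq_card // subsetIr.
      have := partners_ge v; have hg : p * g ^+ 2 * n%:R <= g * n%:R by rewrite ler_wpM2r.
      have : 0 <= #|U|%:R :> R by [].
      by move: hU; rewrite natrD; lra.
    have gn0 : 0 <= g / 2 * n%:R by rewrite mulr_ge0 // divr_ge0 // ltW.
    have hP : (g / 2) ^+ 4 * n%:R ^+ 4 <=
        #|partners E g q.1.1.1 :\: U|%:R * #|partners E g q.1.1.2 :\: U|%:R *
        #|partners E g q.1.2 :\: U|%:R * #|partners E g q.2 :\: U|%:R.
      move: gn0 hX; rewrite -exprMn; move: (g / 2 * _) => c c0 hX.
      rewrite !exprS expr0 mulr1 !mulrA.
      by do 3 (apply: ler_pM => //; rewrite ?mulr_ge0 //).
    have hP3 := ler_wpM2l (exprn_ge0 3 (ltW p0)) hP.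
    have hmu : 3 * mu * n%:R ^+ 4 <= kappa * n%:R ^+ 4.
      rewrite ler_wpM2r ?exprn_ge0 // /kappa.
      by move: mu_small; move: (p ^+ 3 * _) => z; lra.
    have e : p ^+ 3 * ((g / 2) ^+ 4 * n%:R ^+ 4) = 2 * (kappa * n%:R ^+ 4) by rewrite /kappa; field.
    by rewrite e in hP3; lra.
  by rewrite !ltW.
move=> v w U' hw hU'.
apply: le_trans (sum_avoid _ _ _); rewrite card_ord.
have h1 := gad_count hE (ltW p0) (ltW g0) hw.
have h2 : 3 * #|U'|%:R * n%:R ^+ 2 <= p * g ^+ 2 / 32 * n%:R ^+ 3.
  have -> : p * g ^+ 2 / 32 * n%:R ^+ 3 = p * g ^+ 2 / 32 * n%:R * n%:R ^+ 2 by ring.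
  apply: ler_wpM2r; first by rewrite exprn_ge0.
  have : #|U'|%:R <= (#|U| + 16)%:R :> R by rewrite ler_nat.
  by lra.
have h3 : mu <= p * g ^+ 2 / 2.
  apply: le_trans mu_small _.
  have a1 : p ^+ 3 <= p by rewrite exprS ler_piMr ?exprn_ile1 // ltW.
  have a2 : (g / 2) ^+ 4 <= g ^+ 2 * 1.
    have -> : (g / 2) ^+ 4 = g ^+ 2 * (g ^+ 2 / 16) by field.
    rewrite ler_wpM2l ?sqr_ge0 //.
    by have : g ^+ 2 <= 1 by [rewrite exprn_ile1 // ltW]; lra.
  rewrite mulr1 in a2.
  have : p ^+ 3 * (g / 2) ^+ 4 <= p * g ^+ 2.
    by apply: ler_pM => //; rewrite exprn_ge0 // ?divr_ge0 // ltW.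
  by lra.
have h4 : p * g ^+ 2 / 2 * n%:R ^+ 3 <= (p * g ^+ 2 - mu) * n%:R ^+ 3.
  by rewrite ler_wpM2r ?exprn_ge0 //; lra.
have h5 : 0 <= p * g ^+ 2 * n%:R ^+ 3 by rewrite mulr_ge0 ?exprn_ge0 // ltW.
lra.
Qed.

Lemma factor_of_parameters (g : R) (m M : nat) :
  0 < p < 1 -> 0 < g < 1 -> 0 <= mu ->
  mu <= p ^+ 3 * (g / 2) ^+ 4 / 6 ->
  (forall v, g * n%:R <= #|partners E g v|%:R) ->
  (0 < n)%N -> (0 < M)%N -> (4 %| n)%N ->
  let beta := p ^+ 3 * (g / 2) ^+ 4 / 2 * (p * g ^+ 2 / 4) ^+ 4 in
  let s := (n %/ M)%N in
  (1 - beta / 2) ^+ m <= 2^-1 -> (n ^ 4 <= 2 ^ s)%N ->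
  96 * (16 * (2 * m * s) + 16)%:R <= p * g ^+ 2 * n%:R ->
  6 * mu * M%:R ^+ 4 <= p ^+ 3 ->
  has_factor K4minus E.
Proof.
move=> p01 g01 mu_ge0 mu_small partners_ge n0 M0 n4 beta s hm hs hn hM; apply: tiled_factor => //.
have /andP[p0 p1] := p01; have /andP[g0 g1] := g01.
have pg0 : 0 < p * g ^+ 2 by rewrite mulr_gt0 ?exprn_gt0.
have b01 : 0 < beta < 1.
  have x0 : 0 < p ^+ 3 * (g / 2) ^+ 4 by rewrite mulr_gt0 ?exprn_gt0 ?divr_gt0.
  have x1 : p ^+ 3 * (g / 2) ^+ 4 <= 1.
    have h0 : 0 <= g / 2 by lra.
    have h1 : g / 2 <= 1 by lra.
    by rewrite mulr_ile1 ?exprn_ile1 ?exprn_ge0 // ltW.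
  have y1 : (p * g ^+ 2 / 4) ^+ 4 <= 1.
    rewrite exprn_ile1 ?divr_ge0 ?ltW //.
    have : p * g ^+ 2 <= 1 by rewrite mulr_ile1 ?exprn_ile1 ?exprn_ge0 // ltW.
    by lra.
  rewrite /beta mulr_gt0 ?divr_gt0 ?exprn_gt0 ?divr_gt0 //=.
  apply: le_lt_trans (_ : p ^+ 3 * (g / 2) ^+ 4 / 2 < 1); last by lra.
  by rewrite ler_piMr // ltW // divr_gt0.
have cardQ : #|{: 'I_n * 'I_n * 'I_n * 'I_n}| = (n ^ 4)%N.
  by rewrite !card_prod !card_ord; ring.
have cardT : #|{: ('I_n * 'I_n * 'I_n * 'I_n) *
    ('I_n * 'I_n * 'I_n) * ('I_n * 'I_n * 'I_n) * ('I_n * 'I_n * 'I_n) * ('I_n * 'I_n * 'I_n)}| = (n ^ 16)%N.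
  by rewrite !card_prod !card_ord; ring.
have [||U q hU|F [sF uF hF phiF]] := 
  @greedy_family R 'I_n _ _ (absorbs E) (@entA _) beta 16 (2 * m * s) b01 _ _
    (fun=> erefl).
- by rewrite cardT expn_gt0 n0.
- by rewrite cardQ expn_gt0 n0.
- rewrite cardT natrX; apply: many_absorbers => //; apply: le_trans hn.
  by rewrite ler_wpM2l // ler_nat leq_add2r.
(* The potential is at most [n ^ 4 * 2 ^- (2 * s) <= 2 ^- s], and it bounds each single summand. *)
have hX q : (s <= count (absorbs E ^~ q) F)%N.
  have half0 : 0 < 2^-1 :> R by rewrite invr_gt0.
  have half1 : 2^-1 < 1 :> R by lra.
  rewrite -(ler_iXn2l half0 half1).
  have hq : 2^-1 ^+ count (absorbs E ^~ q) F <= \sum_q' 2^-1 ^+ count (absorbs E ^~ q') F :> R.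
    by rewrite (bigD1 q) //= lerDl sumr_ge0 // => q' _; rewrite exprn_ge0 // ltW.
  apply: le_trans hq _; apply: le_trans phiF _; rewrite cardQ.
  have t0 : 0 <= 1 - beta / 2 by lra.
  have h1 : (1 - beta / 2) ^+ (2 * m * s) <= (2^-1 ^+ s) ^+ 2.
    rewrite (mulnC 2) -mulnA (mulnC 2) !exprM.
    by do 2 (apply: lerXn2r; rewrite ?nnegrE ?exprn_ge0 ?invr_ge0 //).
  have h2 : (n ^ 4)%:R <= 2 ^+ s :> R by rewrite -natrX ler_nat.
  apply: le_trans (ler_pM _ _ h2 h1) _ => //; first by rewrite exprn_ge0.
  have h3 : 2 ^+ s * 2^-1 ^+ s = 1 :> R by rewrite exprVn divff // expf_neq0 // pnatr_eq0.
  by rewrite expr2 mulrA h3 mul1r.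
pose X := [seq x <- enum 'I_n | x \notin flatten (map (@entA _) F)].
have uX : uniq X by rewrite filter_uniq ?enum_uniq.
have pX : perm_eq (flatten (map (@entA _) F) ++ X) (enum 'I_n).
  apply: uniq_perm => [||x]; last first.
  - by rewrite mem_cat mem_filter mem_enum andbT orbN.
  - exact: enum_uniq.
  - by rewrite cat_uniq uF uX andbT; apply/hasPn=> x; rewrite mem_filter => /andP[].
have [W [Z tZ pZ] hW] := tiled_greedy E3 uX.
have uW : uniq W by move: uX; rewrite -(perm_uniq pZ) cat_uniq => /and3P[].
(* Otherwise [n <= M * size W], and the copy-free set [W] would satisfy
   [p ^ 3 * |W| ^ 4 <= p ^ 3 / 2 * |W| ^ 4]. *)
have sW : (size W <= 4 * s)%N.
  rewrite leqNgt; apply/negP=> lW.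
  have hfree := copy_free_small (introT andP (conj (ltW p0) (ltW p1))) mu_ge0 uW hW.
  have nW : (n <= M * size W)%N.
    have := ltn_ceil n M0; rewrite -/s => /ltnW h; apply: leq_trans h _.
    by rewrite mulnC leq_mul2l (leq_trans _ lW) ?orbT // ltnS leq_pmull.
  have {}nW : n%:R ^+ 4 <= M%:R ^+ 4 * (size W)%:R ^+ 4 :> R.
    by rewrite -exprMn -natrM lerXn2r // ?nnegrE // ler_nat.
  have hmu : 3 * mu * n%:R ^+ 4 <= 3 * mu * (M%:R ^+ 4 * (size W)%:R ^+ 4).
    by rewrite ler_wpM2l // mulr_ge0.
  have W0 : 0 < (size W)%:R ^+ 4 :> R by rewrite exprn_gt0 // ltr0n (leq_trans _ lW).
  have hM' : 6 * mu * M%:R ^+ 4 * (size W)%:R ^+ 4 <= p ^+ 3 * (size W)%:R ^+ 4.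
    by rewrite ler_pM2r.
  have : 0 < p ^+ 3 * (size W)%:R ^+ 4 by rewrite mulr_gt0 // exprn_gt0.
  by lra.
have W4 : (4 %| size W)%N.
  (* With nothing to absorb the family tiles itself, so its size is a multiple of 4, as are [n] and
     the size of [Z]. *)
  have /tiled_size : tiled E (flatten (map (@entA _) F) ++ [::]) by apply: (@absorb_all _ _ 0).
  have := perm_size pX; have := perm_size pZ; have := tiled_size tZ.
  by move: n4; clear; rewrite -cardE card_ord !size_cat /=; lia.
have tW : tiled E (flatten (map (@entA _) F) ++ W).
  apply: (@absorb_all _ _ (size W %/ 4)) => //.
    by move=> q; apply: leq_trans (hX q); rewrite -(@leq_pmul2l 4) // mulnC divnK.
  by rewrite mulnC divnK.
apply: tiled_perm (tiled_cat tW tZ); apply: perm_trans pX.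
by rewrite -catA perm_cat2l; apply: perm_trans pZ; rewrite perm_catC.
Qed.
End Factor.

(** * Choice of the constants *)

Theorem mainTheorem18 :
  forall (R : realType) (p alpha : R),
    0 < p < 1 -> 0 < alpha < 1 ->
    exists (n0 : nat) (mu : R), 0 < mu /\
      forall (n : nat) (E : {set {set 'I_n}}),
        is_3graph E ->
        cherry_dense p mu E ->
        (forall v : 'I_n, alpha * (n%:R ^+ 2) <= (deg E v)%:R) ->
        (n0 <= n)%N -> (4 %| n)%N ->
        has_factor K4minus E.
Proof.
move=> R p alpha p01 a01; have /andP[p0 p1] := p01; have /andP[a0 a1] := a01.
pose g := p * alpha / 4.
have pa0 : 0 < p * alpha by rewrite mulr_gt0.
have pa1 : p * alpha < 1 by rewrite mulr_ilt1 // ltW.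
have g0 : 0 < g by rewrite divr_gt0.
have g1 : g < 1 by rewrite /g; lra.
have pg0 : 0 < p * g ^+ 2 by rewrite mulr_gt0 ?exprn_gt0.
pose beta := p ^+ 3 * (g / 2) ^+ 4 / 2 * (p * g ^+ 2 / 4) ^+ 4.
have z0 : 0 < p ^+ 3 * (g / 2) ^+ 4 by rewrite mulr_gt0 ?exprn_gt0 ?divr_gt0.
have z1 : p ^+ 3 * (g / 2) ^+ 4 <= g.
  have h1 : p ^+ 3 <= 1 by rewrite exprn_ile1 // ltW.
  have h2 : (g / 2) ^+ 4 <= g.
    have : (g / 2) ^+ 4 <= g / 2 by rewrite exprS ler_piMr ?exprn_ile1 //; lra.
    by lra.
  apply: le_trans h2; rewrite ler_piMl // exprn_ge0 //; lra.
have [m hm] : exists m : nat, (1 - beta / 2) ^+ m <= 2^-1.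
  have b0 : 0 < beta by rewrite mulr_gt0 ?divr_gt0 ?exprn_gt0 ?divr_gt0.
  apply: exists_expr_le_half; rewrite divr_gt0 //=.
  have h1 : (p * g ^+ 2 / 4) ^+ 4 <= 1.
    rewrite exprn_ile1 ?divr_ge0 ?ltW //.
    have : p * g ^+ 2 <= 1 by rewrite mulr_ile1 ?exprn_ile1 ?exprn_ge0 // ltW.
    by lra.
  have : beta <= p ^+ 3 * (g / 2) ^+ 4 / 2 by rewrite /beta ler_piMr // ltW // divr_gt0.
  by lra.
have bound_mul (x : R) : 0 <= x -> exists2 k : nat, (0 < k)%N & x <= p * g ^+ 2 * k%:R.
  move=> x0; exists (Num.bound (x / (p * g ^+ 2))).+1 => //.
  rewrite [leRHS]mulrC -ler_pdivrMr //.
  apply: (@le_trans _ _ (Num.bound (x / (p * g ^+ 2)))%:R); last by rewrite ler_nat leqnSn.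
  by apply/ltW/archi_boundP/divr_ge0; last exact: ltW.
(* [6144 = 2 * 96 * 32] and, below, [3072 = 2 * 96 * 16]: the absorber vertices and the additive 16
   each use at most half of [p * g ^ 2 * n]. *)
have [M Mgt0 hM] := bound_mul (6144 * m%:R) (mulr_ge0 (ler0n _ _) (ler0n _ _)).
have [n1 hn1] := exp4_le_pow2_div Mgt0.
have [n2 n2gt0 hn2] := bound_mul 3072 (ler0n _ _).
(* The first bound serves the absorber count, the second the size of the greedy remainder. *)
pose mu := Num.min (p ^+ 3 * (g / 2) ^+ 4 / 6) (p ^+ 3 / (6 * M%:R ^+ 4)).
have mu0 : 0 < mu.
  rewrite lt_min; apply/andP; split; first by rewrite divr_gt0.
  by rewrite divr_gt0 ?exprn_gt0 // mulr_gt0 // exprn_gt0 // ltr0n.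
have mu1 : mu <= p ^+ 3 * (g / 2) ^+ 4 / 6 by rewrite ge_min lexx.
have mu2 : mu <= p ^+ 3 / (6 * M%:R ^+ 4) by rewrite ge_min lexx orbT.
exists (maxn n1 n2).+1, mu; split=> // n E E3 hE hdeg hn n4.
move: hn; rewrite gtn_max => /andP[/ltnW n1n /ltnW n2n].
have n0 : (0 < n)%N by apply: leq_trans n2n.
apply: (@factor_of_parameters _ _ _ p mu hE E3 g m M) => //.
- by rewrite g0 g1.
- exact: ltW.
- move=> q; apply: (partners_large hE) => //.
    by move: mu1 z1; rewrite /g; move: (p ^+ 3 * _) => z; lra.
  by apply: le_trans (hdeg q) _; rewrite ler_nat deg_le_link.
- exact: hn1.
- have hs : (n %/ M)%:R * M%:R <= n%:R :> R by rewrite -natrM ler_nat leq_divM.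
  have M0 : 0 < M%:R :> R by rewrite ltr0n.
  have h1 : 6144 * m%:R * (n %/ M)%:R <= p * g ^+ 2 * n%:R.
    apply: (@le_trans _ _ (p * g ^+ 2 * M%:R * (n %/ M)%:R)); first by rewrite ler_wpM2r.
    by rewrite -mulrA ler_pM2l // mulrC.
  have h2 : p * g ^+ 2 * n2%:R <= p * g ^+ 2 * n%:R by rewrite ler_pM2l // ler_nat.
  rewrite natrD !natrM; lra.
- move: mu2; rewrite ler_pdivlMr ?mulr_gt0 ?exprn_gt0 ?ltr0n //.
  by apply: le_trans; rewrite le_eqVlt; apply/orP; left; apply/eqP; ring.
Qed.
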